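(* Let $(X,d)$ be a complete geodesic space. Let $H:[0,\infty)\to\mathbb{R}$ be continuous, non-decreasing and convex with $H(0)=0$ and $H(p)/p\to\infty$ as $p\to\infty$. Let $u_0:X\to\mathbb{R}$ be Lipschitz continuous and let $u\in C(X\times[0,\infty))$ be the unique metric viscosity solution (in the class of continuous functions satisfying the linear growth condition given in the context) of $$\partial_t u-H(|\nabla u|)=0\ \text{ in } X\times(0,\infty),\qquad u(\cdot,0)=u_0\ \text{ in } X.$$ Let $\delta>0$. If $u_0$ is uniformly $\infty$-subharmonious with respect to $\delta$, then $u(\cdot,t)$ is uniformly $\infty$-subharmonious with respect to $\delta$ for all $t\ge0$.
   Context: A metric space $(X,d)$ is geodesic if any $x,y\in X$ are joined by a curve $\gamma:[0,1]\to X$ with $\gamma_0=x$, $\gamma_1=y$, $d(\gamma_s,\gamma_t)=|s-t|d(x,y)$. $B_r(z)=\{x\in X:d(z,x)\le r\}$ is the closed ball. A function $f:X\to\mathbb{R}$ is uniformly $\infty$-subharmonious with respect to $\delta>0$ if $2f(z)\le\sup_{B_r(z)}f+\inf_{B_r(z)}f$ for every $z\in X$ and every $r\in(0,\delta]$. Slopes. For $u$ on $X\times(0,\infty)$, $|\nabla u|(x,t)=\limsup_{y\to x}\frac{|u(y,t)-u(x,t)|}{d(x,y)}$ and $|\nabla^\pm u|(x,t)=\limsup_{y\to x}\frac{[u(y,t)-u(x,t)]_\pm}{d(x,y)}$, where $[s]_+=\max\{s,0\}$, $[s]_-=-\min\{s,0\}$. Test functions. $\mathcal{C}$ is the set of locally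 Lipschitz functions $\psi$ on $X\times(0,\infty)$ with $\partial_t\psi$ continuous; $\overline{\mathcal{C}}=\{\psi\in\mathcal{C}: |\nabla^+\psi|=|\nabla\psi|,\ |\nabla\psi| \text{ continuous}\}$; $\underline{\mathcal{C}}=\{\psi\in\mathcal{C}: |\nabla^-\psi|=|\nabla\psi|,\ |\nabla\psi| \text{ continuous}\}$. Metric viscosity solutions of $\partial_tu+G(|\nabla u|)=0$ for a continuous $G:[0,\infty)\to\mathbb{R}$ (here $G=-H$). For $a\ge0$, $p\geq 0$ put $G_a(p)=\inf\{G(p'):p'\ge 0,|p'-p|\le a\}$, $G^a(p)=\sup\{G(p'):p'\ge0,|p'-p|\le a\}$, and $|\nabla\psi|^*(x,t)=\limsup_{(x',t')\to(x,t)}|\nabla\psi|(x',t')$. An upper semicontinuous $u$ on $X\times(0,\infty)$ is a metric viscosity subsolution if whenever $\psi=\psi_1+\psi_2$ with $\psi_1\in\underline{\mathcal{C}}$, $\psi_2\in\mathcal{C}$ and $u-\psi$ has a local maximum at $(x,t)$, then $\partial_t\psi(x,t)+G_{|\nabla\psi_2|^*(x,t)}(|\nabla\psi_1|(x,t))\le0$. A lower semicontinuous $u$ is a metric viscosity supersolution if whenever $\psi=\psi_1+\psi_2$ with $\psi_1\in\overline{\mathcal{C}}$, $\psi_2\in\mathcal{C}$ and $u-\psi$ has a local minimum at $(x,t)$, then $\partial_t\psi(x,t)+G^{|\nabla\psi_2|^*(x,t)}(|\nabla\psi_1|(x,t))\ge0$. A metric viscosity solution is both. Uniqueness class: $u\in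 C(X\times[0,\infty))$ with $|u(x,t)|\le C(d(x_0,x)+t+1)$ for some $C<\infty$ and a fixed $x_0\in X$. It is known (Gangbo–Święch) that the solution exists, is unique in this class, and is given for the present equation by $u(x,t)=\sup_{a\in X}\{u_0(a)-tL(d(a,x)/t)\}$ for $t>0$, where $L(v)=\sup_{p\ge0}(pv-H(p))$, $v\ge0$. *)

(* Defs.v *)
From HB Require Import structures.
From mathcomp Require Import all_boot all_order all_algebra.
From mathcomp Require Import all_classical all_reals all_analysis.

Set Implicit Arguments.
Unset Strict Implicit.
Unset Printing Implicit Defensive.

Import Order.TTheory GRing.Theory Num.Def Num.Theory.
Import numFieldNormedType.Exports.

Local Open Scope classical_set_scope.
Local Open Scope ring_scope.

(* Functions on X x (0, oo) or X x [0, oo) are total functions on X * R; their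
   values at the remaining times are irrelevant to every notion below. *)

Section metric_spaces.
Context {R : realType} {X : metricType R}.
Implicit Types (f : X -> R) (x y z : X).

(* The completeness axiom of completeType, whose points make it unavailable on a
   metricType. *)
Definition complete_space_axiom : Prop :=
  forall F : set_system X, ProperFilter F -> cauchy F -> exists l : X, F --> l.

Definition geodesic_space : Prop :=
  forall x y, exists gamma : R -> X,
    [/\ gamma 0 = x, gamma 1 = y
      & {in `[0, 1] &, forall s t,
          mdist (gamma s) (gamma t) = `|s - t| * mdist x y}].

(* The library's closed_ball is the closure of the open ball. *)
Definition cball z (r : R) : set X := [set x | mdist z x <= r].

Definition lipschitz_fun f : Prop :=
  exists K : R, forall x y, `|f x - f y| <= K * mdist x y.

Definition unif_infty_subharmonious (delta : R) f : Prop :=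
  forall z (r : R), 0 < r <= delta ->
    ((2 * f z)%:E <= ereal_sup [set (f x)%:E | x in cball z r]
                     + ereal_inf [set (f x)%:E | x in cball z r])%E.

End metric_spaces.
Arguments complete_space_axiom {R} X.
Arguments geodesic_space {R} X.

Section viscosity.
Context {R : realType} {X : metricType R}.
Implicit Types (psi u : X * R -> R) (z : X * R).

Definition spacetime : set (X * R) := [set z | 0 < z.2].

Definition locally_lipschitz psi : Prop :=
  forall z, spacetime z -> exists K r : R, 0 < r /\
    forall v w : X * R, ball z r v -> ball z r w ->
      `|psi v - psi w| <= K * (mdist v.1 w.1 + `|v.2 - w.2|).

Definition dt psi z : R := derive1 (fun s => psi (z.1, s)) z.2.

(* The limsup is over y -> x, y <> x. It is finite for locally Lipschitz psi,
   unless x is isolated: it is then the supremum of the empty set, -oo, and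
   fine gives the usual convention that the slope is 0. *)
Definition slope_with (q : R -> R) psi z : R :=
  fine (limf_esup
    (fun y : X => (q (psi (y, z.2) - psi z) / mdist z.1 y)%:E) (z.1)^').

Definition slope := slope_with (fun s => `|s|).
Definition slope_plus := slope_with (fun s => maxr s 0).
Definition slope_minus := slope_with (fun s => - minr s 0).

(* The limsup includes the point z itself: this is the upper semicontinuous
   envelope of the slope. *)
Definition slope_star psi z : R :=
  fine (limf_esup (fun w : X * R => (slope psi w)%:E) (nbhs z)).

Definition test_fun psi : Prop :=
  [/\ locally_lipschitz psi,
      forall z, spacetime z -> derivable (fun s => psi (z.1, s)) z.2 1
    & {within spacetime, continuous (dt psi)}].

Definition upper_test_fun psi : Prop :=
  [/\ test_fun psi,
      forall z, spacetime z -> slope_plus psi z = slope psi z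
    & {within spacetime, continuous (slope psi)}].

Definition lower_test_fun psi : Prop :=
  [/\ test_fun psi,
      forall z, spacetime z -> slope_minus psi z = slope psi z
    & {within spacetime, continuous (slope psi)}].

Definition usc_on (A : set (X * R)) u : Prop :=
  forall z, A z -> forall a : R, u z < a -> \forall w \near within A (nbhs z), u w < a.

Definition lsc_on (A : set (X * R)) u : Prop :=
  forall z, A z -> forall a : R, a < u z -> \forall w \near within A (nbhs z), a < u w.

Definition G_inf (G : R -> R) (a p : R) : R :=
  inf [set G p' | p' in [set p' : R | 0 <= p' /\ `|p' - p| <= a]].
Definition G_sup (G : R -> R) (a p : R) : R :=
  sup [set G p' | p' in [set p' : R | 0 <= p' /\ `|p' - p| <= a]].

Definition metric_viscosity_subsolution (G : R -> R) u : Prop :=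
  usc_on spacetime u /\
  forall psi1 psi2, lower_test_fun psi1 -> test_fun psi2 ->
  forall z, spacetime z ->
    (\forall w \near z, u w - (psi1 w + psi2 w) <= u z - (psi1 z + psi2 z)) ->
    dt (fun w => psi1 w + psi2 w) z
      + G_inf G (slope_star psi2 z) (slope psi1 z) <= 0.

Definition metric_viscosity_supersolution (G : R -> R) u : Prop :=
  lsc_on spacetime u /\
  forall psi1 psi2, upper_test_fun psi1 -> test_fun psi2 ->
  forall z, spacetime z ->
    (\forall w \near z, u z - (psi1 z + psi2 z) <= u w - (psi1 w + psi2 w)) ->
    0 <= dt (fun w => psi1 w + psi2 w) z
           + G_sup G (slope_star psi2 z) (slope psi1 z).

Definition metric_viscosity_solution (G : R -> R) u : Prop :=
  metric_viscosity_subsolution G u /\ metric_viscosity_supersolution G u.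

Definition linear_growth (x0 : X) u : Prop :=
  exists C : R, forall x t, 0 <= t -> `|u (x, t)| <= C * (mdist x0 x + t + 1).

End viscosity.

(* Main.v *)
(* The solution is squeezed against sup_a {u0(a) - l(d(a, x), t)}, where l is a
   C^{1,1} solution of l_t + H(l_d) = 0 obtained from the Hopf-Lax kernel by
   restricting and strictly concavifying the supremum defining L. From below,
   u0(a) - l(d(a, .), t) is itself an admissible test function for the
   supersolution property; from above, the backward cone l(d(., x), T - t),
   continued to all times, is one for the subsolution property. In both
   comparisons the extremum is produced by Ekeland's principle in space, whose
   Lipschitz perturbation is absorbed by the second test function.

   Such a sup-convolution preserves infinity-subharmoniousness: l is
   nondecreasing in the distance, and in a geodesic space every point of
   B_r(z) lies within d(a, z) of some point of B_r(a) and conversely, so the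
   inequality for u0 at a nearly optimal a yields that for u(., t) at z. *)
Require Import Defs.
From mathcomp Require Import all_boot all_order all_algebra.
From mathcomp Require Import all_classical all_reals all_analysis.
From mathcomp Require Import ring lra.
Import Order.TTheory GRing.Theory Num.Def Num.Theory.
Import numFieldNormedType.Exports.
Local Open Scope classical_set_scope.
Local Open Scope ring_scope.

(** * Slopes and one-variable calculus *)

Lemma ler_maxr0B {R : realType} (s t : R) : `|Num.max s 0 - Num.max t 0| <= `|s - t|.
Proof.
have [s0|s0] := leP s 0; have [t0|t0] := leP t 0; rewrite ?subr0 ?sub0r ?normrN ?normr0//.
  by rewrite gtr0_norm// ler0_norm; lra.
by rewrite gtr0_norm// ger0_norm; lra.
Qed.

(** The difference quotient differs from [l] by at most a multiple of [|h|]. The time profile, built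
    from a positive part, and the kernel, built from a maximum, are both differentiated this way. *)
Lemma is_derive_quadratic {R : realType} (f : R -> R) (x l C r : R) : 0 < r ->
  (forall h, `|h| < r -> `|f (x + h) - f x - l * h| <= C * h ^+ 2) ->
  is_derive x 1 f l.
Proof.
move=> r0 fC.
suff : h^-1 *: (f (h *: 1 + x) - f x) @[h --> 0^'] --> l.
  move=> fl; apply: DeriveDef; first by apply/cvg_ex; exists l.
  exact/cvg_lim.
apply/cvgrPdist_le => e e0.
have C1 : 0 < `|C| + 1 by rewrite ltr_wpDl.
near=> h.
have h0 : h != 0 by near: h; exact: nbhs_dnbhs_neq.
have hr : `|h| < r by near: h; exact: dnbhs0_lt.
have he : `|h| < e / (`|C| + 1) by near: h; apply: dnbhs0_lt; rewrite divr_gt0.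
have nh : 0 < `|h| by rewrite normr_gt0.
rewrite -(ler_pM2r nh) -normrM mulrBl [_%:A]mulr1 [_ *: _]mulrC divfK//.
rewrite distrC (addrC h) (le_trans (fC _ hr))// -real_normK ?num_real// expr2 mulrA ler_wpM2r//.
rewrite ltr_pdivlMr// in he.
rewrite (le_trans _ (ltW he))// mulrC ler_wpM2l// (le_trans (ler_norm C))//; lra.
Unshelve. all: by end_near. Qed.

Lemma derivable_continuous_lipschitz {R : realType} {f f' : R -> R} (t : R) :
  (forall s : R, is_derive s 1 f (f' s)) -> {for t, continuous f'} ->
  exists L r, [/\ 0 <= L, 0 < r & forall s s', `|t - s| < r -> `|t - s'| < r ->
    `|f s - f s'| <= L * `|s - s'|].
Proof.
move=> df cf'.
have /cvgrPdist_lt/(_ 1 ltr01)/nbhs_ballP[r /= r0 ball_r] := cf'.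
have f'L s : `|t - s| < r -> `|f' s| <= `|f' t| + 1.
  move=> ts; have /= h := ball_r s ts.
  have := ler_normD (f' t) (- (f' t - f' s)); rewrite normrN opprB addrC subrK; lra.
exists (`|f' t| + 1), r; split=> //.
move=> s s'; wlog ss' : s s' / s <= s' => [hw ts ts'|ts ts'].
  have [|/ltW] := leP s s' => ss; first exact: hw.
  by rewrite distrC (distrC s); exact: hw.
have [|c cs E] := @MVT_segment _ f f' _ _ ss' (fun s _ => df s).
  apply: continuous_subspaceT => x; apply: differentiable_continuous.
  by apply/derivable1_diffP; have [] := df x.
rewrite distrC (distrC s) E normrM ler_wpM2r// f'L//.
move: cs ts ts'; rewrite in_itv/= !ltr_norml => /andP[? ?] /andP[? ?] /andP[? ?].
by apply/andP; split; lra.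
Qed.

Lemma continuous_lipschitz2 {R : realType} {T : topologicalType} {f : R -> R -> R}
    {A B : R} {v w : T -> R} :
  (forall d t d' t', `|f d t - f d' t'| <= A * `|d - d'| + B * `|t - t'|) ->
  continuous v -> continuous w -> continuous (fun z => f (v z) (w z)).
Proof.
move=> fL cv cw z; apply/cvgrPdist_le => e e0.
have A1 : 0 < 2 * (`|A| + 1) by rewrite mulr_gt0// ltr_wpDl.
have B1 : 0 < 2 * (`|B| + 1) by rewrite mulr_gt0// ltr_wpDl.
near=> y.
have hv : `|v z - v y| <= e / (2 * (`|A| + 1)).
  by near: y; apply: cvgr_dist_le; [exact: cv|rewrite divr_gt0].
have hw : `|w z - w y| <= e / (2 * (`|B| + 1)).
  by near: y; apply: cvgr_dist_le; [exact: cw|rewrite divr_gt0].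
rewrite ler_pdivlMr// in hv; rewrite ler_pdivlMr// in hw.
apply: le_trans (fL _ _ _ _) _.
have := ler_wpM2r (normr_ge0 (v z - v y)) (ler_norm A).
have := ler_wpM2r (normr_ge0 (w z - w y)) (ler_norm B).
have := normr_ge0 (v z - v y); have := normr_ge0 (w z - w y).
lra.
Unshelve. all: by end_near. Qed.

Section slopes.
Context {R : realType} {X : metricType R}.

Lemma mdist_lipschitz (x y a : X) : `|mdist x a - mdist y a| <= mdist x y.
Proof.
have h1 := metric_triangle x y a; have h2 := metric_triangle y x a.
by rewrite (metric_sym y x) in h2; rewrite ler_norml; apply/andP; split; lra.
Qed.

Lemma continuous_mdist_fst (a : X) : continuous (fun z : X * R => mdist z.1 a).
Proof.
move=> z; apply/cvgrPdist_lt => e e0; near=> w.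
apply: le_lt_trans (mdist_lipschitz _ _ _) _.
suff : ball z.1 e w.1 by rewrite ballEmdist.
near: w; have : nbhs z.1 (ball z.1 e) by exact: nbhsx_ballx.
exact: cvg_fst.
Unshelve. all: by end_near. Qed.

Lemma within_continuous_eq {f g : X * R -> R} (A : set (X * R)) :
  (forall z, A z -> g z = f z) -> continuous f -> {within A, continuous g}.
Proof.
move=> fg cf; apply: (subspace_eq_continuous (f := f)).
  by move=> z; rewrite inE => Az; apply/esym/fg.
exact: continuous_subspaceT.
Qed.

Lemma limf_esup_le {T : topologicalType} {F : set_system T} {g : T -> R} {c : R} :
  (\forall y \near F, g y <= c) -> (limf_esup (fun y => (g y)%:E) F <= c%:E)%E.
Proof.
move=> gc; apply: ge_ereal_inf; exists (ereal_sup [set (g y)%:E | y in [set y | g y <= c]]).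
  by exists [set y | g y <= c].
by apply: ge_ereal_sup => _ [y gy <-]; rewrite lee_fin.
Qed.

Lemma limf_esup_ge {T : topologicalType} {F : set_system T} {g : T -> R} {c : R} :
  (forall V, F V -> exists2 y, V y & c <= g y) ->
  (c%:E <= limf_esup (fun y => (g y)%:E) F)%E.
Proof.
move=> gc; apply: le_ereal_inf_tmp => _ [V FV <-].
have [y Vy cy] := gc V FV.
by apply: le_ereal_sup_tmp; exists (g y)%:E; rewrite ?lee_fin//; exists y.
Qed.

(* Over the improper filter the limsup is -oo, and fine turns it into 0. *)
Lemma fine_limf_esup_ge0 {T : topologicalType} {F : set_system T} {g : T -> R} :
  (forall y, 0 <= g y) -> 0 <= fine (limf_esup (fun y => (g y)%:E) F).
Proof.
move=> g0; have [F0|F0] := pselect (F set0).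
  suff -> : limf_esup (fun y => (g y)%:E) F = -oo%E by [].
  apply/eqP; rewrite -leeNy_eq; apply: ge_ereal_inf; exists -oo%E => //.
  by exists set0 => //; rewrite image_set0 ereal_sup0.
apply: fine_ge0; apply: limf_esup_ge => V FV.
have [y Vy] : V !=set0 by apply/set0P/eqP => V0; rewrite V0 in FV.
by exists y.
Qed.

(** [0 <= c] covers the value [-oo], which [fine] sends to 0. *)
Lemma fine_limf_esup_le {T : topologicalType} {F : set_system T} {g : T -> R} {c : R} :
  0 <= c -> (\forall y \near F, g y <= c) ->
  fine (limf_esup (fun y => (g y)%:E) F) <= c.
Proof. by move=> c0 /limf_esup_le; case: limf_esup. Qed.

(** The upper bound [b] excludes [+oo], which [fine] would send to 0. *)
Lemma fine_limf_esup_ge {T : topologicalType} {F : set_system T} {g : T -> R} {b c : R} :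
  (\forall y \near F, g y <= b) ->
  (forall V, F V -> exists2 y, V y & c <= g y) ->
  c <= fine (limf_esup (fun y => (g y)%:E) F).
Proof. by move=> /limf_esup_le + /limf_esup_ge; case: limf_esup. Qed.

(** For [l = 0] the lower bound is free because slopes are nonnegative. This alternative serves the
    centre of a barrier, which may even be an isolated point. *)
Lemma slope_with_eq {q : R -> R} {psi : X * R -> R} {z : X * R} {l : R} :
  0 <= l -> (forall s, 0 <= q s) ->
  (forall e, 0 < e -> \forall y \near z.1^',
    q (psi (y, z.2) - psi z) / mdist z.1 y <= l + e) ->
  (l = 0 \/ forall e V, 0 < e -> z.1^' V ->
    exists2 y, V y & l - e <= q (psi (y, z.2) - psi z) / mdist z.1 y) ->
  slope_with q psi z = l.
Proof.
move=> l0 q0 upper lower; apply/eqP; rewrite eq_le; apply/andP; split.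
  apply/ler_addgt0Pl => e e0; rewrite addrC; apply: fine_limf_esup_le.
    by rewrite addr_ge0// ltW.
  exact: upper.
case: lower => [->|lower].
  by apply: fine_limf_esup_ge0 => y; rewrite divr_ge0 ?mdist_ge0.
apply/ler_addgt0Pl => e e0; rewrite addrC -lerBlDr.
by apply: (fine_limf_esup_ge (upper _ ltr01)) => V; exact: lower.
Qed.

Lemma slope_ge0 {psi : X * R -> R} {z} : 0 <= slope psi z.
Proof. by apply: fine_limf_esup_ge0 => y; rewrite divr_ge0 ?mdist_ge0. Qed.

Section distance_perturbation.
Context {c : R} {y0 : X}.
Let pert (z : X * R) := c * mdist z.1 y0.

Lemma slope_mdist_le z : slope pert z <= `|c|.
Proof.
apply: fine_limf_esup_le => //; near=> y.
have xy : 0 < mdist z.1 y.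
  by rewrite mdist_gt0 eq_sym; near: y; exact: nbhs_dnbhs_neq.
rewrite ler_pdivrMr// /pert/= -mulrBr normrM ler_wpM2l//.
by rewrite (metric_sym z.1 y) mdist_lipschitz.
Unshelve. all: by end_near. Qed.

(** This bounds the radius over which [G_inf] and [G_sup] range once Ekeland's penalty is taken as
    the second test function. *)
Lemma slope_star_mdist_itv z : 0 <= slope_star pert z <= `|c|.
Proof.
apply/andP; split; first by apply: fine_limf_esup_ge0 => w; exact: slope_ge0.
by apply: fine_limf_esup_le => //; apply: nearW => w; exact: slope_mdist_le.
Qed.

Lemma is_derive_mdist z : is_derive z.2 (1 : R) (fun s : R => pert (z.1, s)) (0 : R).
Proof. by rewrite /pert/=; exact: (is_derive_cst (c * mdist z.1 y0)). Qed.

Lemma test_fun_mdist : test_fun pert.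
Proof.
split=> [z _|z _|].
- exists `|c|, 1; split=> // v w _ _.
  rewrite /pert -mulrBr normrM ler_wpM2l//.
  by rewrite (le_trans (mdist_lipschitz _ _ _))// lerDl.
- by apply: ex_derive; exact: is_derive_mdist.
- apply: (within_continuous_eq (f := fun=> 0)) => [z _|z]; last exact: cvg_cst.
  by rewrite /dt derive1E; have [_] := is_derive_mdist z.
Qed.

End distance_perturbation.
End slopes.

(** * Piecewise quadratic functions of time *)

Section time_profile.
Context {R : realType} {kappa alpha beta c : R}.

(** One C^1 family provides both the clock [sigma] and the time correction [b] of a barrier: affine
    up to time [c], with a quadratic term switched on afterwards. *)
Definition time_profile (t : R) : R :=
  kappa + alpha * t + beta * Num.max (t - c) 0 ^+ 2.
Definition time_profile_slope (t : R) : R := alpha + 2 * beta * Num.max (t - c) 0.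

Lemma time_profile_derive (t : R) :
  is_derive t 1 time_profile (time_profile_slope t).
Proof.
apply: (@is_derive_quadratic _ _ _ _ `|beta| 1) => // h _.
have -> : time_profile (t + h) - time_profile t - time_profile_slope t * h =
    beta * (Num.max (t - c + h) 0 ^+ 2 - Num.max (t - c) 0 ^+ 2
      - 2 * Num.max (t - c) 0 * h).
  by rewrite /time_profile /time_profile_slope (addrAC t h); ring.
rewrite normrM ler_wpM2l//; move: (t - c) => s.
by rewrite ler_norml; have [s0|s0] := leP s 0; have [sh|sh] := leP (s + h) 0;
  apply/andP; split; nra.
Qed.

Lemma time_profile_slope_continuous : continuous time_profile_slope.
Proof.
move=> t; apply/cvgrPdist_le => e e0.
have L0 : 0 < `|2 * beta| + 1 by rewrite ltr_wpDl.
near=> s.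
have ts : `|t - s| < e / (`|2 * beta| + 1).
  by near: s; exact: (nbhsx_ballx t _ (divr_gt0 e0 L0)).
rewrite ltr_pdivlMr// in ts.
rewrite /time_profile_slope opprD addrACA subrr add0r -mulrBr normrM.
have := ler_maxr0B (t - c) (s - c).
have -> : t - c - (s - c) = t - s by ring.
move=> /(ler_wpM2l (normr_ge0 (2 * beta))).
have := normr_ge0 (t - s); lra.
Unshelve. all: by end_near. Qed.

End time_profile.

(** * Ekeland's variational principle *)

Section variational_principle.
Context {R : realType} {X : metricType R}.
Hypothesis X_complete : complete_space_axiom X.

(** The distances are dominated by decrements of [a], which is nonincreasing and bounded below,
    hence Cauchy. *)
Lemma cauchy_seq_cvg {y : nat -> X} {a : nat -> R} {l : R} :
  (forall n m, (n <= m)%N -> mdist (y n) (y m) <= a n - a m) ->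
  (forall n, l <= a n) ->
  exists2 x : X, y @ \oo --> x & cvgn a.
Proof.
move=> ya la.
have a_noninc : nonincreasing_seq a.
  move=> n m nm; rewrite -subr_ge0; exact: le_trans (mdist_ge0 _ _) (ya _ _ nm).
have a_cvg : cvgn a.
  by apply: nonincreasing_is_cvgn => //; exists l => _ [n _ <-].
have [x yx] : exists x : X, y @ \oo --> x.
  apply: X_complete; apply: cauchy_exP => e e0.
  have /cvgrPdist_lt/(_ e e0)[N _ aN] := a_cvg.
  exists (y N); exists N => // n /= Nn.
  rewrite ballEmdist/=; apply: le_lt_trans (ya _ _ Nn) _.
  have h1 := nonincreasing_cvgn_ge a_noninc a_cvg n.
  have h2 := nonincreasing_cvgn_ge a_noninc a_cvg N.
  have := aN N (leqnn N); rewrite ltr_norml => /andP[]; lra.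
by exists x.
Qed.

(** [S x] collects the points whose gain in [m] pays for their distance to [x] at rate [k]. It is a
    preorder, and a sequence descending in it by nearly optimal steps converges to a point that no
    other point of its own [S] can beat. *)
Lemma ekeland {m : X -> R} {l k : R} (y0 : X) : 0 < k ->
  (forall y, l <= m y) ->
  (forall y c, c < m y -> \forall y' \near y, c < m y') ->
  exists2 y, m y <= m y0 & forall y', m y <= m y' + k * mdist y y'.
Proof.
move=> k0 lm m_lsc.
pose S x := [set y | m y + k * mdist x y <= m x].
have S_refl x : S x x by rewrite /S/= mdistxx mulr0 addr0.
have S_trans x y z : S x y -> S y z -> S x z.
  rewrite /S/= => xy yz; have := ler_wpM2l (ltW k0) (metric_triangle x y z); lra.
pose i x := inf (m @` S x).
have i_lb x : has_lbound (m @` S x) by exists l => _ [y _ <-].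
have i_le x y : S x y -> i x <= m y by move=> xy; apply: ge_inf => //; exists y.
(* The next point closes at least half of the gap between [m x] and the infimum of [m] over [S x];
   without a gap it may be [x] itself. *)
have /choice[next nextP] : forall x, exists y, S x y /\ m y <= (m x + i x) / 2.
  move=> x.
  have := i_le _ _ (S_refl x); rewrite le_eqVlt => /predU1P[ix|ix].
    by exists x; split=> //; lra.
  have d0 : 0 < (m x - i x) / 2 by lra.
  have [|_ [y xy <-] my] := @inf_adherent _ (m @` S x) _ d0.
    by split => //; exists (m x); exists x.
  by exists y; split=> //; rewrite -/(i x) in my; lra.
pose y n := iter n next y0.
have yS n j : (n <= j)%N -> S (y n) (y j).
  move=> /subnK <-; elim: (j - n)%N => [|p ih]; first by rewrite add0n.
  by rewrite addSn; apply: S_trans ih _; have [] := nextP (y (p + n)%N).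
have [x yx m_cvg] : exists2 x : X, y @ \oo --> x & cvgn (fun n => k^-1 * m (y n)).
  apply: (@cauchy_seq_cvg _ _ (k^-1 * l)) => [n j nj|n].
    rewrite -mulrBr mulrC ler_pdivlMr// mulrC.
    have := yS _ _ nj; rewrite /S/=; lra.
  by rewrite ler_pM2l ?invr_gt0.
have {}m_cvg : cvgn (m \o y).
  rewrite (_ : m \o y = (fun n => k * (k^-1 * m (y n)))); last first.
    by apply/funext => n /=; rewrite mulrA divff ?mul1r// gt_eqF.
  by apply: is_cvgM => //; exact: is_cvg_cst.
have m_noninc : nonincreasing_seq (m \o y).
  move=> n j nj /=; have := yS _ _ nj; rewrite /S/=.
  by have := mulr_ge0 (ltW k0) (mdist_ge0 (y n) (y j)); lra.
have mx n : m x <= m (y n).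
  rewrite leNgt; apply/negP => lt.
  have /m_lsc near_x := lt.
  have [N _ yN] : \forall j \near \oo, m (y n) < m (y j) by have := yx _ near_x.
  have := yN (maxn N n) (leq_maxl _ _).
  by rewrite ltNge (m_noninc n)// leq_maxr.
have xS n : S (y n) x.
  rewrite /S/=; apply/ler_addgt0Pl => e e0.
  have [N _ yN] : \forall j \near \oo, mdist x (y j) < e / k.
    by apply: metricType_numDomainType.cvgr_dist_lt => //; rewrite divr_gt0.
  pose j := maxn N n.
  have := yS n j (leq_maxr _ _); have := yN j (leq_maxl _ _).
  rewrite /S/= ltr_pdivlMr// => xj nj.
  have := ler_wpM2l (ltW k0) (metric_triangle (y n) (y j) x).
  rewrite (metric_sym (y j)); have := mx j; lra.
exists x => [|y']; first exact: (mx 0%N).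
rewrite leNgt; apply/negP => lt.
have xy' : S x y' by rewrite /S/= ltW.
(* The halving bounds [m y'] from below by a quantity that tends to the limit of [m (y n)], which is
   at least [m x]. *)
have le n : 2 * m (y n.+1) - m (y n) <= m y'.
  have := i_le _ _ (S_trans _ _ _ (xS n) xy').
  by have [_] := nextP (y n); rewrite -/(y n.+1); lra.
have := mulr_ge0 (ltW k0) (mdist_ge0 x y').
suff : m x <= m y' by lra.
rewrite leNgt; apply/negP => lt'.
have /cvgrPdist_lt/(_ ((m x - m y') / 2))[|N _ mN] := m_cvg; first lra.
have := le N; have := mx N.+1.
have := mN N.+1 (leqnSn _); have := mN N (leqnn _); rewrite /= !ltr_norml.
have h1 := nonincreasing_cvgn_ge m_noninc m_cvg N.
have h2 := nonincreasing_cvgn_ge m_noninc m_cvg N.+1.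
rewrite /= in h1 h2.
move=> /andP[? ?] /andP[? ?] ? ?.
have : m x <= limn (m \o y) by apply: limr_ge => //; exact: nearW.
lra.
Qed.

(* The time variable stays in a compact interval, so that it can be minimized
   out and only the space variable needs a perturbation. *)
Lemma ekeland_spacetime {F : X * R -> R} {M l k : R} (z0 : X * R) :
  0 < k -> 0 < z0.2 < M -> continuous F ->
  (forall y t, 0 <= t <= M -> l <= F (y, t)) ->
  (forall y, 0 <= F (y, 0)) -> (forall y, 0 <= F (y, M)) -> F z0 < 0 ->
  exists y t, 0 < t < M /\
    forall y' t', 0 <= t' <= M -> F (y, t) <= F (y', t') + k * mdist y y'.
Proof.
case: z0 => y0 t0 /= k0 /andP[t00 t0M] F_cont lF F0 FM Fneg.
have M0 : 0 < M by exact: lt_trans t0M.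
have /choice[tau tauP] : forall y, exists t, 0 <= t <= M /\
    forall t', 0 <= t' <= M -> F (y, t) <= F (y, t').
  move=> y.
  have [|t tM tmin] := @EVT_min _ (fun t => F (y, t)) _ _ (ltW M0).
    apply: continuous_subspaceT => t.
    apply: (@continuous_comp _ _ _ (fun t => (y, t)) F); last exact: F_cont.
    by exact: (cvg_pair (cvg_cst _) cvg_id).
  exists t; split=> [|t' t'M]; first by rewrite in_itv in tM.
  by apply: tmin; rewrite in_itv.
pose m y := F (y, tau y).
(* Tube argument: by compactness of [[0, M]], a strict inequality valid at all times at [y] persists
   uniformly in time near [y]. *)
have m_lsc y c : c < m y -> \forall y' \near y, c < m y'.
  move=> cm.
  have : \forall y' \near y, [set` `[0, M]] `<=` (fun t => c < F (y', t)).
    move/compact_near_coveringP : (@segment_compact R 0 M); apply => t /=.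
    rewrite in_itv/= => tM.
    have cF : c < F (y, t) by apply: lt_le_trans cm _; have [_] := tauP y; apply.
    have [[A B] [/= yA tB] AB] : \forall z \near (y, t), c < F z.
      by apply: (F_cont (y, t) [set s | c < s]); exact: lt_nbhsr.
    by exists (B, A) => // -[t' y'] /= [? ?]; exact: AB.
  apply: filterS => y'; apply; rewrite /= in_itv/=.
  by have [] := tauP y'.
have lm y : l <= m y by apply: lF; have [] := tauP y.
have [y my0 my] := ekeland y0 k0 lm m_lsc.
have [tauM tau_min] := tauP y.
have mneg : F (y, tau y) < 0.
  apply: le_lt_trans my0 (le_lt_trans _ Fneg).
  by have [_] := tauP y0; apply; rewrite !ltW.
exists y, (tau y); split=> [|y' t' t'M].
  (* The minimal time is interior, since [F] is nonnegative at both end times and negative at the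
     point found. *)
  have {tauM} /andP[] := tauM; rewrite !le_eqVlt => /predU1P[e|->].
    by have := F0 y; have := mneg; rewrite -e; lra.
  move=> /predU1P[e|->]//.
  by have := FM y; have := mneg; rewrite e; lra.
apply: le_trans (my y') _; rewrite lerD2r.
by have [_] := tauP y'; apply.
Qed.

End variational_principle.

(** * The regularized Hopf-Lax kernel *)

Section convex_hamiltonian.
Context {R : realType} {H : R -> R}.
Hypothesis H_mono : {in `[0, +oo[ &, {homo H : p q / p <= q}}.
Hypothesis H_convex : convex_function (`[0, +oo[%classic : set R) H.
Hypothesis H0 : H 0 = 0.

Lemma hamiltonian_le {p q : R} : 0 <= p -> p <= q -> H p <= H q.
Proof.
move=> p0 pq; apply: H_mono => //; rewrite in_itv/= andbT//.
exact: le_trans pq.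
Qed.

Lemma hamiltonian_ge0 {p : R} : 0 <= p -> 0 <= H p.
Proof. by move=> p0; rewrite -H0; exact: hamiltonian_le. Qed.

Lemma hamiltonian_conv {t p q : R} : 0 <= t <= 1 -> 0 <= p -> 0 <= q ->
  H (t * p + (1 - t) * q) <= t * H p + (1 - t) * H q.
Proof.
move=> /andP[t0 t1] p0 q0.
have := @H_convex (Itv01 t0 t1) p q.
by rewrite !convRE/=; apply; rewrite inE/= in_itv/= andbT.
Qed.

(* Up to K the increments of the convex H are dominated by its increment over
   an interval of length at least 1 beyond K. *)
Lemma hamiltonian_lipschitz {K p q : R} : 0 <= p <= K -> 0 <= q <= K ->
  `|H p - H q| <= H (K + 1) * `|p - q|.
Proof.
wlog pq : p q / p <= q => [hw pK qK|].
  have [|/ltW] := leP p q => pq; first exact: hw.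
  by rewrite distrC (distrC p); exact: hw.
move=> /andP[p0 pK] /andP[q0 qK].
rewrite distrC (distrC p) !ger0_norm ?subr_ge0//; last exact: hamiltonian_le.
pose s := K + 1 - p.
have s1 : 1 <= s by rewrite /s; lra.
have s0 : 0 < s by lra.
pose t := (K + 1 - q) / s.
have t0 : 0 <= t by rewrite divr_ge0//; [lra|exact: ltW].
have t1 : t <= 1 by rewrite ler_pdivrMr//; rewrite /s; lra.
have ts : t * s = K + 1 - q by rewrite /t divfK ?gt_eqF.
have ts' : (1 - t) * s = q - p by rewrite mulrBl mul1r ts /s; ring.
have qE : q = t * p + (1 - t) * (K + 1).
  have -> : t * p + (1 - t) * (K + 1) = K + 1 - t * s by rewrite /s; ring.
  by rewrite ts; ring.
have t01 : 0 <= t <= 1 by rewrite t0.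
have K1 : 0 <= K + 1 by lra.
have := hamiltonian_conv t01 p0 K1; rewrite -qE => Hq.
have Hp0 := hamiltonian_ge0 p0.
have HK0 := hamiltonian_ge0 K1.
have tq : 1 - t <= q - p.
  by rewrite -ts' -[leLHS]mulr1 ler_wpM2l// subr_ge0.
have : (1 - t) * H (K + 1) <= (q - p) * H (K + 1) by rewrite ler_wpM2r.
have : (1 - t) * H p >= 0 by rewrite mulr_ge0// subr_ge0.
lra.
Qed.

Context {K eps : R}.
Hypothesis K_gt0 : 0 < K.
Hypothesis eps_gt0 : 0 < eps.

(** The positive part of [t] keeps the objective concave in [p] at negative times as well. *)
Definition kernel_obj (d t p : R) : R :=
  p * d - Num.max t 0 * H p - eps * p ^+ 2 / 2.

(* The maximizer is unique, and it is the spatial derivative of the kernel. *)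
Definition kernel_arg (d t : R) : R :=
  xget 0 [set p | 0 <= p <= K /\
    forall q, 0 <= q <= K -> kernel_obj d t q <= kernel_obj d t p].

(* A regularization of the Hopf-Lax kernel t L(d / t) that is C^{1,1}, also at
   d = 0 and t = 0, and still solves l_t + H(l_d) = 0 exactly: the supremum
   defining L is restricted to p <= K and made strictly concave. *)
Definition kernel (d t : R) : R := kernel_obj d t (kernel_arg d t).

(** A maximizer exists because [H] is Lipschitz on [[0, K]], so the default value of [xget] never
    occurs. *)
Lemma kernel_argP d t : 0 <= kernel_arg d t <= K /\
  forall q, 0 <= q <= K -> kernel_obj d t q <= kernel d t.
Proof.
rewrite /kernel /kernel_arg; case: xgetP => [p -> []//|noarg]; exfalso.
have cobj : {within `[0, K], continuous (kernel_obj d t)}.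
  have HL : {within `[0, K], continuous H}.
    apply/subspace_continuousP => x /=; rewrite in_itv/= => x0K.
    apply/cvgrPdist_le => e e0.
    have L0 : 0 <= H (K + 1) by apply: hamiltonian_ge0; have := ltW K_gt0; lra.
    have L1 : 0 < H (K + 1) + 1 by lra.
    near=> y.
    have yK : y \in `[0, K] by near: y; exact: withinT.
    rewrite (le_trans (hamiltonian_lipschitz x0K _))//.
    have /ltW : `|x - y| < e / (H (K + 1) + 1).
      by near: y; apply: cvg_within; apply: nbhsx_ballx; rewrite divr_gt0.
    by rewrite ler_pdivlMr// mulrC => /(le_trans _); apply; rewrite ler_wpM2r//; lra.
  have cX : {within `[0, K], continuous (fun p : R => p)}.
    by apply: continuous_subspaceT => x; exact: cvg_id.
  rewrite /kernel_obj => x; apply: cvgB; first apply: cvgB.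
  - by apply: cvgMl; exact: cX.
  - by apply: cvgMr; exact: HL.
  - apply: cvgMl; apply: cvgMr.
    by rewrite (_ : (fun p : R => _) = (fun p => p * p))//; apply: cvgM; exact: cX.
have [c cK cmax] := EVT_max (ltW K_gt0) cobj.
apply: (noarg c); split=> [|q qK]; first by rewrite in_itv in cK.
by apply: cmax; rewrite in_itv.
Unshelve. all: by end_near. Qed.

Lemma kernel_arg_itv d t : 0 <= kernel_arg d t <= K.
Proof. by have [] := kernel_argP d t. Qed.

Lemma kernel_arg_ge0 d t : 0 <= kernel_arg d t.
Proof. by have /andP[] := kernel_arg_itv d t. Qed.

Lemma kernel_arg_leK d t : kernel_arg d t <= K.
Proof. by have /andP[] := kernel_arg_itv d t. Qed.

Lemma kernel_ge {d t q} : 0 <= q <= K -> kernel_obj d t q <= kernel d t.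
Proof. by have [_] := kernel_argP d t; apply. Qed.

(** The maximum is compared with the midpoint of [q] and the maximizer, where the quadratic term
    gains [eps / 8] times the squared distance over the average; doubling gives [eps / 4]. *)
Lemma kernel_obj_strongly_concave {d t q} : 0 <= q <= K ->
  kernel_obj d t q + eps / 4 * (q - kernel_arg d t) ^+ 2 <= kernel d t.
Proof.
move=> qK; set p := kernel_arg d t.
have pK := kernel_arg_itv d t; rewrite -/p in pK.
have [/andP[p0 pK'] /andP[q0 qK']] := (pK, qK).
pose m := 1 / 2 * p + (1 - 1 / 2) * q.
have mK : 0 <= m <= K by rewrite /m; apply/andP; split; lra.
have := kernel_ge (d := d) (t := t) mK.
have half01 : (0 <= 1 / 2 :> R) && (1 / 2 <= 1 :> R) by apply/andP; split; lra.
have := hamiltonian_conv half01 p0 q0; rewrite -/m.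
rewrite /kernel -/p /kernel_obj => Hm.
set T := Num.max t 0.
have T0 : 0 <= T by rewrite le_max lexx orbT.
have := ler_wpM2l T0 Hm; rewrite /m => Hm'; nra.
Qed.

(** The maximizer at [(d, t)] is a competitor at [(d', t')]. The Lipschitz bound, monotonicity and
    time derivative of the kernel all come from this supporting inequality. *)
Lemma kernel_first_order d t d' t' :
  kernel d t + kernel_arg d t * (d' - d)
    - H (kernel_arg d t) * (Num.max t' 0 - Num.max t 0) <= kernel d' t'.
Proof.
apply: le_trans (kernel_ge (kernel_arg_itv d t)).
rewrite /kernel /kernel_obj; lra.
Qed.

(** Adding the strong concavity inequalities at the two points, each tested with the other
    maximizer, leaves only cross terms linear in [|p - p'|] against its square. *)
Lemma kernel_arg_lipschitz d t d' t' :
  `|kernel_arg d t - kernel_arg d' t'|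
    <= 2 / eps * (`|d - d'| + H (K + 1) * `|t - t'|).
Proof.
set p := kernel_arg d t; set p' := kernel_arg d' t'.
have pK := kernel_arg_itv d t; have pK' := kernel_arg_itv d' t'.
have := kernel_obj_strongly_concave (d := d) (t := t) pK'.
have := kernel_obj_strongly_concave (d := d') (t := t') pK.
rewrite /kernel /kernel_obj -/p -/p' => h1 h2.
have hT := ler_maxr0B t t'.
set T := Num.max t 0 in h2 hT; set T' := Num.max t' 0 in h1 hT.
have hH := hamiltonian_lipschitz pK pK'; rewrite -/p -/p' in hH.
have h3 : eps / 2 * (p - p') ^+ 2 <= (p - p') * (d - d') - (T - T') * (H p - H p').
  by lra.
have h4 : (p - p') * (d - d') <= `|p - p'| * `|d - d'|.
  by rewrite -normrM ler_norm.
have h5 : - ((T - T') * (H p - H p')) <= `|t - t'| * (H (K + 1) * `|p - p'|).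
  rewrite (le_trans (ler_norm _))// normrN normrM ler_pM//.
have HK0 : 0 <= H (K + 1) by apply: hamiltonian_ge0; have := ltW K_gt0; lra.
have [->|pp] := eqVneq p p'.
  rewrite subrr normr0; apply: mulr_ge0; first by rewrite divr_ge0// ltW.
  by rewrite addr_ge0// mulr_ge0.
have npp : 0 < `|p - p'| by rewrite normr_gt0 subr_eq0.
rewrite mulrAC ler_pdivlMr// -(ler_pM2l npp).
move: h3; rewrite -real_normK ?num_real// => h3; lra.
Qed.

Lemma kernel_lipschitz d t d' t' :
  `|kernel d t - kernel d' t'| <= K * `|d - d'| + H K * `|t - t'|.
Proof.
have half a b a' b' : kernel a b - kernel a' b' <= K * `|a - a'| + H K * `|b - b'|.
  have := kernel_first_order a b a' b'.
  set p := kernel_arg a b.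
  have p0 := kernel_arg_ge0 a b; have pK := kernel_arg_leK a b.
  have h1 : p * (a - a') <= K * `|a - a'|.
    by rewrite (le_trans (ler_norm _))// normrM ger0_norm// ler_wpM2r.
  have h2 : H p * (Num.max b' 0 - Num.max b 0) <= H K * `|b - b'|.
    rewrite (le_trans (ler_norm _))// normrM ger0_norm ?hamiltonian_ge0//.
    by rewrite ler_pM ?hamiltonian_ge0 ?hamiltonian_le// distrC ler_maxr0B.
  lra.
by rewrite ler_norml half andbT lerNl opprB (distrC d) (distrC t) half.
Qed.

(** The competitor [K]. Growth at rate [K] in the distance absorbs the linear growth of the solution
    and provides the lower bounds needed for Ekeland's principle. *)
Lemma kernel_ge_linear d t : K * d - Num.max t 0 * H K - eps * K ^+ 2 / 2 <= kernel d t.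
Proof. by apply: kernel_ge; rewrite lexx ltW. Qed.

(** At distance 0 the objective is nonpositive and vanishes at [p = 0]. The cone is therefore flat
    at its tip, which makes it an admissible test function there too. *)
Lemma kernel_arg0 t : kernel_arg 0 t = 0.
Proof.
set p := kernel_arg 0 t.
have p0 : 0 <= p := kernel_arg_ge0 0 t.
have := @kernel_ge 0 t 0; rewrite lexx ltW// => /(_ isT).
rewrite /kernel /kernel_obj -/p H0 => h.
have : 0 <= Num.max t 0 * H p by rewrite mulr_ge0 ?hamiltonian_ge0// le_max lexx orbT.
move=> h'; apply/eqP; rewrite eq_le p0 andbT leNgt; apply/negP => pp.
have : 0 < eps * p ^+ 2 / 2 by rewrite divr_gt0// mulr_gt0// exprn_gt0.
move: h; rewrite expr0n/= !(mulr0, mul0r); lra.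
Qed.

Lemma kernel_at0 t : kernel 0 t = 0.
Proof. by rewrite /kernel kernel_arg0 /kernel_obj H0 expr0n/= !(mulr0, mul0r) !subr0. Qed.

Lemma kernel_mono {t} : {homo kernel^~ t : d d' / d <= d'}.
Proof.
move=> d d' dd'; have := kernel_first_order d t d' t.
rewrite subrr mulr0 subr0; apply: le_trans.
by rewrite lerDl mulr_ge0// ?kernel_arg_ge0// subr_ge0.
Qed.

Lemma kernel_derive {d t : R} : 0 < t ->
  is_derive t 1 (kernel d) (- H (kernel_arg d t)).
Proof.
move=> t0.
(* The first-order inequalities at [t] and [t + h] enclose the increment up to [(H p - H p') * h].
   One factor [H (K + 1)] is the Lipschitz constant of [H], the rest that of the maximizer in
   time. *)
apply: (@is_derive_quadratic _ _ _ _ (2 / eps * H (K + 1) * H (K + 1)) t) => // h ht.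
have th0 : 0 < t + h by move: ht; rewrite ltr_norml => /andP[]; lra.
have := kernel_first_order d (t + h) d t; have := kernel_first_order d t d (t + h).
rewrite !subrr !mulr0 !addr0 !(max_l (ltW _))//.
set p := kernel_arg d t; set p' := kernel_arg d (t + h) => h1 h2.
have := hamiltonian_lipschitz (kernel_arg_itv d t) (kernel_arg_itv d (t + h)).
rewrite -/p -/p' => hH.
have := kernel_arg_lipschitz d t d (t + h); rewrite -/p -/p'.
rewrite subrr normr0 add0r opprD addrA subrr sub0r normrN => hp.
have Hge : 0 <= H (K + 1) by apply: hamiltonian_ge0; have := ltW K_gt0; lra.
have hHp : `|(H p - H p') * h| <= 2 / eps * H (K + 1) * H (K + 1) * h ^+ 2.
  rewrite normrM -[h ^+ 2]real_normK ?num_real// expr2 mulrA ler_wpM2r//.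
  rewrite (le_trans hH)// (le_trans (ler_wpM2l Hge hp))// le_eqVlt; apply/orP; left.
  by apply/eqP; ring.
have := ler_norm ((H p - H p') * h).
rewrite ler_norml; move: h1 h2 => h1 h2 h3; apply/andP; split; lra.
Qed.

(** * Test functions built from the kernel *)

Lemma kernel_arg_continuous {T : topologicalType} {v w : T -> R} :
  continuous v -> continuous w -> continuous (fun z => kernel_arg (v z) (w z)).
Proof.
apply: (@continuous_lipschitz2 _ _ _ (2 / eps) (2 / eps * H (K + 1))).
by move=> d t d' t'; have := kernel_arg_lipschitz d t d' t'; rewrite mulrDr mulrA.
Qed.

Lemma kernel_continuous {T : topologicalType} {v w : T -> R} :
  continuous v -> continuous w -> continuous (fun z => kernel (v z) (w z)).
Proof. by apply: continuous_lipschitz2 => d t d' t'; exact: kernel_lipschitz. Qed.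

Lemma hamiltonian_ge0_K1 : 0 <= H (K + 1).
Proof. by apply: hamiltonian_ge0; rewrite addr_ge0// ltW. Qed.

Lemma hamiltonian_kernel_arg_continuous {T : topologicalType} {v w : T -> R} :
  continuous v -> continuous w ->
  continuous (fun z => H (kernel_arg (v z) (w z))).
Proof.
apply: (@continuous_lipschitz2 _ _ (fun d t => H (kernel_arg d t))
  (H (K + 1) * (2 / eps)) (H (K + 1) * (2 / eps * H (K + 1)))) => d t d' t'.
apply: le_trans (hamiltonian_lipschitz (kernel_arg_itv _ _) (kernel_arg_itv _ _)) _.
have := ler_wpM2l hamiltonian_ge0_K1 (kernel_arg_lipschitz d t d' t').
by move=> /le_trans; apply; rewrite le_eqVlt; apply/orP; left; apply/eqP; ring.
Qed.

(** Used to choose Ekeland's constant [k]: shifting a slope by [k] must change [H] by less than the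
    strictness margin [eta] of the barrier. *)
Lemma hamiltonian_modulus {eta : R} : 0 < eta ->
  exists k, 0 < k /\ forall p, 0 <= p <= K ->
    H (p + k) - H p < eta /\ H p - H (Num.max (p - k) 0) < eta.
Proof.
(* Since [k <= 1], the shifted slopes stay below [K + 1], and [L] is the Lipschitz constant of [H]
   up to there. *)
move=> eta0; pose L := H (K + 1 + 1).
have K1 : 0 <= K + 1 by rewrite addr_ge0// ltW.
have L0 : 0 <= L by apply: hamiltonian_ge0; rewrite addr_ge0.
have L1 : 0 < L + 1 by lra.
pose k := Num.min 1 (eta / (L + 1)).
have k0 : 0 < k by rewrite lt_min ltr01 divr_gt0.
have k1 : k <= 1 by rewrite ge_min lexx.
have Lk : L * k < eta.
  have : k <= eta / (L + 1) by rewrite ge_min lexx orbT.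
  rewrite ler_pdivlMr//; lra.
have lip q q' : 0 <= q -> q <= q' -> q' <= K + 1 -> q' - q <= k -> H q' - H q < eta.
  move=> q0 qq' qK qk.
  have q'K : 0 <= q' <= K + 1 by rewrite (le_trans q0).
  have qK1 : 0 <= q <= K + 1 by rewrite q0 (le_trans qq').
  have := hamiltonian_lipschitz q'K qK1; rewrite -/L.
  have := ler_norm (H q' - H q); rewrite (ger0_norm (x := q' - q)) ?subr_ge0// => h1 h2.
  have := ler_wpM2l L0 qk; lra.
exists k; split=> // p /andP[p0 pK]; split; first by apply: lip; lra.
by have [pk|pk] := leP (p - k) 0; apply: lip; lra.
Qed.

Context {X : metricType R}.
Hypothesis X_geodesic : geodesic_space X.
Section barrier.
Context {a : X} {sigma dsigma b db : R -> R}.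
Hypothesis sigma_gt0 : forall t, 0 < t -> 0 < sigma t.
Hypothesis sigma_derive : forall t : R, is_derive t 1 sigma (dsigma t).
Hypothesis dsigma_cont : continuous dsigma.
Hypothesis b_derive : forall t : R, is_derive t 1 b (db t).
Hypothesis db_cont : continuous db.

(** [sigma] runs forward for supersolutions and backward for subsolutions; [b] makes the resulting
    inequality strict and handles the end times. *)
Definition barrier (z : X * R) : R := kernel (mdist z.1 a) (sigma z.2) + b z.2.
Definition barrier_arg (z : X * R) : R := kernel_arg (mdist z.1 a) (sigma z.2).
Definition barrier_dt (z : X * R) : R := - H (barrier_arg z) * dsigma z.2 + db z.2.

Lemma continuous_time {f df : R -> R} : (forall t : R, is_derive t 1 f (df t)) ->
  continuous (fun z : X * R => f z.2).
Proof.
move=> fd z; apply: (@continuous_comp _ _ _ (@snd X R) f); first exact: cvg_snd.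
by apply: differentiable_continuous; apply/derivable1_diffP; have [] := fd z.2.
Qed.

Lemma barrier_continuous : continuous barrier.
Proof.
move=> z; apply: cvgD; last exact: (continuous_time b_derive).
apply: (kernel_continuous (v := fun z => mdist z.1 a) (w := fun z => sigma z.2)); first exact: continuous_mdist_fst.
exact: (continuous_time sigma_derive).
Qed.

Lemma barrier_arg_continuous : continuous barrier_arg.
Proof.
apply: (kernel_arg_continuous (v := fun z => mdist z.1 a) (w := fun z => sigma z.2)); first exact: continuous_mdist_fst.
exact: (continuous_time sigma_derive).
Qed.

Lemma barrier_derive z : spacetime z ->
  is_derive z.2 1 (fun s => barrier (z.1, s)) (barrier_dt z).
Proof.
move=> /sigma_gt0 s0.
have k_derive := kernel_derive (d := mdist z.1 a) s0.
have ks_derive := is_derive1_comp k_derive (sigma_derive z.2).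
exact: is_deriveD ks_derive (b_derive z.2).
Qed.

Lemma barrier_dtE z : spacetime z -> dt barrier z = barrier_dt z.
Proof. by move=> /barrier_derive[_ <-]; rewrite /dt derive1E. Qed.

Lemma barrier_dt_continuous : continuous barrier_dt.
Proof.
move=> z; apply: cvgD; last first.
  by apply: (@continuous_comp _ _ _ (@snd X R) db); [exact: cvg_snd|exact: db_cont].
apply: cvgM; last first.
  by apply: (@continuous_comp _ _ _ (@snd X R) dsigma); [exact: cvg_snd|exact: dsigma_cont].
apply: cvgN; apply: (hamiltonian_kernel_arg_continuous (v := fun z => mdist z.1 a) (w := fun z => sigma z.2)); first exact: continuous_mdist_fst.
exact: (continuous_time sigma_derive).
Qed.

Lemma barrier_test : test_fun barrier.
Proof.
split=> [z _|z /barrier_derive[]//|].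
- have [L1 [r1 [L10 r10 h1]]] := derivable_continuous_lipschitz z.2 sigma_derive (@dsigma_cont _).
  have [L2 [r2 [L20 r20 h2]]] := derivable_continuous_lipschitz z.2 b_derive (@db_cont _).
  have HK0 : 0 <= H K by apply: hamiltonian_ge0; exact: ltW.
  exists (K + H K * L1 + L2), (Num.min r1 r2); split; first by rewrite lt_min r10.
  move=> [v1 v2] [w1 w2] [/= _ zv] [/= _ zw].
  move: zv zw; rewrite /ball/= !lt_min => /andP[v_r1 v_r2] /andP[w_r1 w_r2].
  have {h1}h1 := h1 _ _ v_r1 w_r1; have {h2}h2 := h2 _ _ v_r2 w_r2.
  rewrite /barrier/= opprD addrACA (le_trans (ler_normD _ _))//.
  have h3 := kernel_lipschitz (mdist v1 a) (sigma v2) (mdist w1 a) (sigma w2).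
  have h4 := ler_wpM2l (ltW K_gt0) (mdist_lipschitz v1 w1 a).
  have h5 := ler_wpM2l HK0 h1.
  have h6 : 0 <= K * `|v2 - w2| by rewrite mulr_ge0// ltW.
  have h7 : 0 <= (H K * L1 + L2) * mdist v1 w1 by rewrite mulr_ge0 ?mdist_ge0// addr_ge0// mulr_ge0.
  lra.
- apply: (@within_continuous_eq _ _ barrier_dt); first exact: barrier_dtE.
  exact: barrier_dt_continuous.
Qed.

Lemma barrier_arg_le (x y : X) (t : R) : barrier_arg (y, t) <= barrier_arg (x, t) + 2 / eps * mdist x y.
Proof.
have := kernel_arg_lipschitz (mdist y a) (sigma t) (mdist x a) (sigma t).
rewrite subrr normr0 mulr0 addr0 => h.
have h' : 2 / eps * `|mdist y a - mdist x a| <= 2 / eps * mdist x y.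
  by rewrite ler_wpM2l ?divr_ge0 ?(ltW eps_gt0)// (metric_sym x y) mdist_lipschitz.
have := ler_norm (barrier_arg (y, t) - barrier_arg (x, t)); rewrite /barrier_arg/= in h h' *; lra.
Qed.

(** An increment is controlled by the maximizer at the endpoint it leads to; replacing that
    maximizer by the one at [x] costs at most [2 / eps] times the distance. *)
Lemma barrier_lipschitz_at (x y : X) (t : R) :
  `|barrier (y, t) - barrier (x, t)| <= (barrier_arg (x, t) + 2 / eps * mdist x y) * mdist x y.
Proof.
have half x' y' : barrier (y', t) - barrier (x', t) <= barrier_arg (y', t) * mdist x' y'.
  have := kernel_first_order (mdist y' a) (sigma t) (mdist x' a) (sigma t).
  have := ler_wpM2l (kernel_arg_ge0 (mdist y' a) (sigma t)) (mdist_lipschitz x' y' a).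
  have := kernel_arg_ge0 (mdist y' a) (sigma t).
  rewrite /barrier /barrier_arg/= subrr mulr0 => p0.
  have := ler_wpM2l p0 (ler_norm (mdist y' a - mdist x' a)); rewrite distrC; lra.
have L0 : 0 <= 2 / eps * mdist x y by rewrite mulr_ge0 ?divr_ge0 ?mdist_ge0 ?(ltW eps_gt0).
rewrite ler_norml; apply/andP; split; last first.
  by apply: le_trans (half x y) _; rewrite ler_wpM2r ?mdist_ge0// barrier_arg_le.
rewrite lerNl opprB; apply: le_trans (half y x) _.
by rewrite metric_sym ler_wpM2r ?mdist_ge0// lerDl.
Qed.

(* The barrier decreases at the full rate along a geodesic towards its centre. *)
Lemma barrier_slope (q : R -> R) z : (forall s, 0 <= q s) ->
  (forall s, q s <= `|s|) -> (forall s, - s <= q s) ->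
  slope_with q barrier z = barrier_arg z.
Proof.
case: z => x t q0 q_norm q_neg.
have L0 : 0 < 2 / eps by rewrite divr_gt0.
apply: slope_with_eq => //= [|e e0|].
- exact: kernel_arg_ge0.
- near=> y.
  have xy : 0 < mdist x y.
    by rewrite mdist_gt0 eq_sym; near: y; exact: nbhs_dnbhs_neq.
  rewrite ler_pdivrMr// (le_trans (q_norm _))// (le_trans (barrier_lipschitz_at _ _ _))//.
  rewrite ler_wpM2r ?mdist_ge0// lerD2l.
  suff : mdist x y < e / (2 / eps) by rewrite ltr_pdivlMr// mulrC => /ltW.
  suff : ball x (e / (2 / eps)) y by rewrite ballEmdist.
  by near: y; apply: nbhs_dnbhs; apply: nbhsx_ballx; rewrite divr_gt0.
- have [xa|xa] := eqVneq x a.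
    by left; rewrite /barrier_arg/= xa mdistxx kernel_arg0.
  right=> e V e0 /nbhs_ballP[r /= r0 rV].
  have D0 : 0 < mdist x a by rewrite mdist_gt0.
  have [gamma [g0 g1 g_geo]] := X_geodesic x a.
  (* The three bounds keep the step from overshooting [a], keep it inside [V], and let the maximizer
     vary by at most [e]. *)
  pose rho := Num.min (mdist x a) (Num.min (r / 2) (e / (2 / eps))).
  have rho0 : 0 < rho by rewrite !lt_min D0 !divr_gt0.
  have [rhoD [rhor rhoe]] : rho <= mdist x a /\ rho <= r / 2 /\ rho <= e / (2 / eps).
    by rewrite !ge_min !lexx !orbT.
  pose s := rho / mdist x a.
  have sD : s * mdist x a = rho by rewrite divfK ?gt_eqF.
  have s0 : 0 <= s by rewrite divr_ge0// ltW.
  have s1 : s <= 1 by rewrite ler_pdivrMr// mul1r.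
  have s_in : s \in `[0, 1] by rewrite in_itv/= s0.
  have in0 : (0 : R) \in `[0, 1] by rewrite in_itv/= lexx ler01.
  have in1 : (1 : R) \in `[0, 1] by rewrite in_itv/= lexx ler01.
  have xg : mdist x (gamma s) = rho.
    by rewrite -g0 g_geo// sub0r normrN ger0_norm// g0.
  have ga : mdist (gamma s) a = mdist x a - rho.
    by rewrite -[in LHS]g1 g_geo// distrC ger0_norm ?subr_ge0// mulrBl mul1r sD.
  exists (gamma s).
    apply: rV => /=; first by rewrite ballEmdist/= xg; lra.
    by rewrite eq_sym -mdist_gt0 xg.
  rewrite xg ler_pdivlMr// (le_trans _ (q_neg _))// opprB.
  have := kernel_first_order (mdist (gamma s) a) (sigma t) (mdist x a) (sigma t).
  rewrite subrr mulr0 /barrier/= {2}ga => h1.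
  have h2 := barrier_arg_le (gamma s) x t; rewrite /barrier_arg/= (metric_sym (gamma s) x) xg in h2.
  rewrite ler_pdivlMr// mulrC in rhoe.
  rewrite /barrier_arg/=; move: h1 h2; rewrite ga.
  move: (kernel_arg _ _) (kernel_arg _ _) => p' p h1 h2.
  have : (p' - e) * rho <= p * rho by apply: ler_wpM2r; [exact: ltW|lra].
  lra.
Unshelve. all: by end_near. Qed.

Lemma slope_barrier z : slope barrier z = barrier_arg z.
Proof. by apply: barrier_slope => // s; rewrite -normrN ler_norm. Qed.

Lemma slope_minus_barrier z : slope_minus barrier z = barrier_arg z.
Proof.
apply: barrier_slope => s; have [s0|s0] := leP s 0; rewrite ?oppr0//; try lra.
by rewrite -normrN ler_norm.
Qed.

Lemma barrier_lower_test : lower_test_fun barrier.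
Proof.
split; first exact: barrier_test.
  by move=> z _; rewrite slope_barrier slope_minus_barrier.
apply: within_continuous_eq barrier_arg_continuous => z _.
exact: slope_barrier.
Qed.

(** Supersolutions are touched from below, by the negative of the barrier: descent of the barrier
    becomes the ascent required of an upper test function. *)
Definition opp_barrier (z : X * R) := - barrier z.

Lemma slope_opp_barrier z : slope opp_barrier z = barrier_arg z.
Proof.
rewrite -slope_barrier /slope /slope_with /opp_barrier; congr (fine (limf_esup _ _)).
by apply/funext => y; rewrite -opprD normrN.
Qed.

Lemma slope_plus_opp_barrier z : slope_plus opp_barrier z = barrier_arg z.
Proof.
rewrite -slope_minus_barrier /slope_plus /slope_minus /slope_with /opp_barrier.
congr (fine (limf_esup _ _)).
by apply/funext => y; rewrite -opprD -[in Num.max _ _]oppr0 -oppr_min.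
Qed.

Lemma barrier_opp_derive z : spacetime z ->
  is_derive z.2 1 (fun s => opp_barrier (z.1, s)) (- barrier_dt z).
Proof. by move=> /barrier_derive; exact: is_deriveN. Qed.

Lemma opp_barrier_upper_test : upper_test_fun opp_barrier.
Proof.
have [lip _ _] := barrier_test.
split; first split.
- move=> z /lip[L [r [r0 h]]]; exists L, r; split=> // v w zv zw.
  by rewrite /opp_barrier -opprD normrN; exact: h.
- by move=> z /barrier_opp_derive[].
- apply: (@within_continuous_eq _ _ (fun z => - barrier_dt z)).
    by move=> z s; rewrite /dt derive1E; have [] := barrier_opp_derive z s.
  by move=> z; apply: cvgN; exact: barrier_dt_continuous.
- by move=> z _; rewrite slope_opp_barrier slope_plus_opp_barrier.
- apply: within_continuous_eq barrier_arg_continuous => z _.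
  exact: slope_opp_barrier.
Qed.


(** The penalty is the second test function. Its slope is at most [k], so [G_inf] only sees slopes
    up to [barrier_arg z + k], and [H] is nondecreasing. *)
Lemma subsolution_barrier {u : X * R -> R} {k : R} {z : X * R} :
  0 <= k -> metric_viscosity_subsolution (fun p => - H p) u -> spacetime z ->
  (\forall w \near z, u w - barrier w <= u z - barrier z + k * mdist w.1 z.1) ->
  barrier_dt z <= H (barrier_arg z + k).
Proof.
move=> k0 [_ u_sub] z0 zmax.
have := u_sub _ _ barrier_lower_test (test_fun_mdist (c := k) (y0 := z.1)) z z0.
have /andP[s0 sk] := slope_star_mdist_itv (c := k) (y0 := z.1) z.
rewrite ger0_norm// in sk; rewrite slope_barrier.
set s := slope_star _ _ in s0 sk *.
(* The penalty does not depend on time. *)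
have -> : dt (fun w => barrier w + k * mdist w.1 z.1) z = barrier_dt z.
  have [_ E] := is_deriveD (barrier_derive z z0) (is_derive_mdist (c := k) (y0 := z.1) z).
  by rewrite /dt derive1E [LHS]E addr0.
move=> h.
have {h} : barrier_dt z + G_inf (fun p => - H p) s (barrier_arg z) <= 0.
  apply: h; apply: filterS zmax => w; rewrite mdistxx; lra.
suff : - H (barrier_arg z + k) <= G_inf (fun p => - H p) s (barrier_arg z) by lra.
have arg0 : 0 <= barrier_arg z by exact: kernel_arg_ge0.
apply: lb_le_inf.
  by exists (- H (barrier_arg z)); exists (barrier_arg z) => //=; rewrite subrr normr0.
move=> _ [p [p0 pa] <-]; rewrite lerN2; apply: hamiltonian_le => //.
have := ler_norm (p - barrier_arg z); lra.
Qed.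

(** The mirror argument with penalty [- k]; the slopes seen by [G_sup] are at least
    [barrier_arg z - k] and nonnegative, hence the truncation at 0. *)
Lemma supersolution_barrier {u : X * R -> R} {k : R} {z : X * R} :
  0 <= k -> metric_viscosity_supersolution (fun p => - H p) u -> spacetime z ->
  (\forall w \near z, u z + barrier z <= u w + barrier w + k * mdist w.1 z.1) ->
  barrier_dt z + H (Num.max (barrier_arg z - k) 0) <= 0.
Proof.
move=> k0 [_ u_super] z0 zmin.
have := u_super _ _ opp_barrier_upper_test (test_fun_mdist (c := - k) (y0 := z.1)) z z0.
have /andP[s0 sk] := slope_star_mdist_itv (c := - k) (y0 := z.1) z.
rewrite normrN ger0_norm// in sk; rewrite slope_opp_barrier.
set s := slope_star _ _ in s0 sk *.
have -> : dt (fun w => opp_barrier w + - k * mdist w.1 z.1) z = - barrier_dt z.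
  have [_ E] := is_deriveD (barrier_opp_derive z z0) (is_derive_mdist (c := - k) (y0 := z.1) z).
  by rewrite /dt derive1E [LHS]E addr0.
move=> h.
have {h} : 0 <= - barrier_dt z + G_sup (fun p => - H p) s (barrier_arg z).
  apply: h; apply: filterS zmin => w; rewrite mdistxx /opp_barrier; lra.
suff : G_sup (fun p => - H p) s (barrier_arg z) <= - H (Num.max (barrier_arg z - k) 0) by lra.
have arg0 : 0 <= barrier_arg z by exact: kernel_arg_ge0.
apply: ge_sup.
  by exists (- H (barrier_arg z)); exists (barrier_arg z) => //=; rewrite subrr normr0.
move=> _ [p [p0 pa] <-]; rewrite lerN2; apply: hamiltonian_le.
  by rewrite le_max lexx orbT.
rewrite ge_max p0 andbT.
have := ler_norm (- (p - barrier_arg z)); rewrite normrN; lra.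
Qed.

(** * Comparison of the solution with a strict barrier *)

Hypothesis X_complete : complete_space_axiom X.
Context {u : X * R -> R} {M l eta : R}.
Hypothesis u_cont : {within [set z : X * R | 0 <= z.2], continuous u}.
Hypothesis eta_gt0 : 0 < eta.
Hypothesis db_ge : forall t, 0 < t < M -> eta <= db t.

(** Freezing [u] at its initial values for negative times makes it continuous on all of [X * R], as
    [ekeland_spacetime] requires. *)
Lemma continuous_max_time : continuous (fun z : X * R => u (z.1, Num.max z.2 0)).
Proof.
move=> z.
have z0 : 0 <= Num.max z.2 0 by rewrite le_max lexx orbT.
have cz : {for z, continuous (fun w : X * R => (w.1, Num.max w.2 0))}.
  apply: (cvg_pair (G := nbhs z.1) (H := nbhs (Num.max z.2 0))); first exact: cvg_fst.
  apply/cvgrPdist_lt => e e0; near=> w.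
  apply: le_lt_trans (ler_maxr0B _ _) _.
  by near: w; apply: cvgr_dist_lt => //; exact: cvg_snd.
have /subspace_continuousP/(_ (z.1, Num.max z.2 0) z0) u_at := u_cont.
move=> V /u_at; rewrite /= => uV.
have := cz _ uV; rewrite /= !nbhs_simpl/=.
apply: filterS => w /=; apply.
by rewrite le_max lexx orbT.
Unshelve. all: by end_near. Qed.

Lemma near_spacetime {z : X * R} : spacetime z -> \forall w \near z, spacetime w.
Proof.
move=> z0; have c : (fun w : X * R => w.2) @ z --> z.2 by exact: cvg_snd.
exact: (cvgr_gt _ c).
Qed.

Lemma near_time_lt {z : X * R} : z.2 < M -> \forall w \near z, w.2 < M.
Proof.
move=> zM; have c : (fun w : X * R => w.2) @ z --> z.2 by exact: cvg_snd.
exact: (cvgr_lt _ c).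
Qed.

(** A negative value would give, by Ekeland, an interior touching point. With [sigma] of slope 1 the
    viscosity inequality there makes [H] drop by at least [eta] under a shift of the slope by [k],
    against the choice of [k]. *)
Lemma supersolution_comparison :
  metric_viscosity_supersolution (fun p => - H p) u ->
  (forall t, 0 < t < M -> dsigma t = 1) ->
  (forall y t, 0 <= t <= M -> l <= u (y, t) + barrier (y, t)) ->
  (forall y, 0 <= u (y, 0) + barrier (y, 0)) ->
  (forall y, 0 <= u (y, M) + barrier (y, M)) ->
  forall z, 0 < z.2 < M -> 0 <= u z + barrier z.
Proof.
move=> u_super sigma1 lF F0 FM z zM.
rewrite leNgt; apply/negP => Fz.
have M0 : 0 < M by case/andP: zM; exact: lt_trans.
have [k [k0 modk]] := hamiltonian_modulus eta_gt0.
pose F w := u (w.1, Num.max w.2 0) + barrier w.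
have FE y t : 0 <= t -> F (y, t) = u (y, t) + barrier (y, t).
  by move=> t0; rewrite /F/= max_l.
have [|y t tM|y|y||y [t [tM yt_min]]] := @ekeland_spacetime _ _ X_complete F M l k z k0 zM.
- by move=> w; apply: cvgD; [exact: continuous_max_time|exact: barrier_continuous].
- by rewrite FE; [exact: lF|case/andP: tM].
- by rewrite FE.
- by rewrite FE// ltW.
- by case: z zM Fz => y t /= /andP[/ltW t0 _] ?; rewrite FE.
have /andP[t0 tltM] := tM.
have := @supersolution_barrier u k (y, t) (ltW k0) u_super t0.
rewrite /barrier_dt/= sigma1// mulr1 => h.
have {h} : - H (barrier_arg (y, t)) + db t + H (Num.max (barrier_arg (y, t) - k) 0) <= 0.
  apply: h; apply: filterS2 (near_spacetime (z := (y, t)) t0) (near_time_lt (z := (y, t)) tltM).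
  move=> [y' t'] /= t'0 t'M.
  rewrite -!FE ?(ltW t0) ?(ltW t'0)// (metric_sym y').
  by apply: yt_min; rewrite !ltW.
have [_] := modk _ (kernel_arg_itv (mdist y a) (sigma t)).
have := db_ge t tM; rewrite /barrier_arg/=; lra.
Qed.

(** The same contradiction with the clock reversed: [H] would rise by at least [eta] under a shift
    by [k]. *)
Lemma subsolution_comparison :
  metric_viscosity_subsolution (fun p => - H p) u ->
  (forall t, 0 < t < M -> dsigma t = - 1) ->
  (forall y t, 0 <= t <= M -> l <= barrier (y, t) - u (y, t)) ->
  (forall y, u (y, 0) <= barrier (y, 0)) ->
  (forall y, u (y, M) <= barrier (y, M)) ->
  forall z, 0 < z.2 < M -> u z <= barrier z.
Proof.
move=> u_sub sigma1 lF F0 FM z zM.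
rewrite leNgt; apply/negP => Fz.
have M0 : 0 < M by case/andP: zM; exact: lt_trans.
have [k [k0 modk]] := hamiltonian_modulus eta_gt0.
pose F w := barrier w - u (w.1, Num.max w.2 0).
have FE y t : 0 <= t -> F (y, t) = barrier (y, t) - u (y, t).
  by move=> t0; rewrite /F/= max_l.
have [|y t tM|y|y||y [t [tM yt_min]]] := @ekeland_spacetime _ _ X_complete F M l k z k0 zM.
- by move=> w; apply: cvgB; [exact: barrier_continuous|exact: continuous_max_time].
- by rewrite FE; [exact: lF|case/andP: tM].
- by rewrite FE// subr_ge0.
- by rewrite FE ?subr_ge0// ltW.
- by case: z zM Fz => y t /= /andP[/ltW t0 _] ?; rewrite FE// subr_lt0.
have /andP[t0 tltM] := tM.
have := @subsolution_barrier u k (y, t) (ltW k0) u_sub t0.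
rewrite /barrier_dt/= sigma1// mulrN1 opprK => h.
have {h} : H (barrier_arg (y, t)) + db t <= H (barrier_arg (y, t) + k).
  apply: h; apply: filterS2 (near_spacetime (z := (y, t)) t0) (near_time_lt (z := (y, t)) tltM).
  move=> [y' t'] /= t'0 t'M.
  have t'M' : 0 <= t' <= M by rewrite !ltW.
  have := yt_min y' t' t'M'.
  rewrite !FE ?(ltW t0) ?(ltW t'0)// (metric_sym y); lra.
have [+ _] := modk _ (kernel_arg_itv (mdist y a) (sigma t)).
have := db_ge t tM; rewrite /barrier_arg/=; lra.
Qed.

End barrier.

(** * Comparison with the kernel *)

Context {u : X * R -> R} {x0 : X} {C : R}.
Hypothesis X_complete : complete_space_axiom X.
Hypothesis u_cont : {within [set z : X * R | 0 <= z.2], continuous u}.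
Hypothesis C_ge0 : 0 <= C.
Hypothesis CK : C <= K.
Hypothesis u_growth : forall x t, 0 <= t -> `|u (x, t)| <= C * (mdist x0 x + t + 1).

Lemma growth_le_coercive (a y : X) (t : R) : 0 <= t ->
  `|u (y, t)| <= C * (mdist x0 a + t + 1) + K * mdist y a.
Proof.
move=> t0; apply: le_trans (u_growth _ _ t0) _.
have := ler_wpM2l C_ge0 (metric_triangle x0 a y); rewrite (metric_sym a).
have := ler_wpM2r (mdist_ge0 y a) CK; lra.
Qed.

(** The loss [eps * K ^+ 2 / 2] is what the kernel at time 0 may lack compared with [K] times the
    distance, the Lipschitz bound on the initial values. *)
Lemma supersolution_ge_kernel (a x : X) (t : R) :
  metric_viscosity_supersolution (fun p => - H p) u ->
  (forall y, `|u (y, 0) - u (a, 0)| <= K * mdist y a) -> 0 < t ->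
  u (a, 0) - kernel (mdist x a) t - eps * K ^+ 2 / 2 <= u (x, t).
Proof.
move=> u_super u0_lip t0; apply/ler_addgt0Pr => e e0.
have HK0 : 0 <= H K by apply: hamiltonian_ge0; exact: ltW.
have tt0 : 0 < t + t ^+ 2 by rewrite addr_gt0// exprn_gt0.
(* The correction [eta * (s + s ^+ 2)] amounts to exactly [e] at [s = t]. *)
pose eta := e / (t + t ^+ 2).
have eta0 : 0 < eta by rewrite divr_gt0.
have etaE : eta * (t + t ^+ 2) = e by rewrite divfK// gt_eqF.
pose A := C + H K.
pose B := C * (mdist x0 a + 1) + `|u (a, 0)|.
have A0 : 0 <= A by rewrite addr_ge0.
have B0 : 0 <= B by rewrite addr_ge0// mulr_ge0// addr_ge0// mdist_ge0.
(* At this late time the quadratic correction outweighs the linear lower bound [- (A * M + B)], so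
   the final comparison holds. *)
pose M := t + 1 + (A + B) / eta.
have AB0 : 0 <= (A + B) / eta by apply: divr_ge0; [exact: addr_ge0|exact: ltW].
have tM : t < M by rewrite /M; lra.
have M1 : 1 <= M by rewrite /M; lra.
have etaM : A * M + B <= eta * M ^+ 2.
  have : (A + B) / eta <= M by rewrite /M; lra.
  rewrite ler_pdivrMr// => h.
  have h1 : 0 <= M by lra.
  have := ler_wpM2r h1 h; have := ler_wpM2l B0 M1; lra.
pose b := @time_profile R (- u (a, 0) + eps * K ^+ 2 / 2) eta eta 0.
have bE s : 0 <= s -> b s = - u (a, 0) + eps * K ^+ 2 / 2 + eta * (s + s ^+ 2).
  by move=> s0; rewrite /b /time_profile subr0 max_l//; ring.
pose sigma := @time_profile R 0 1 0 0.
have sigmaE s : sigma s = s by rewrite /sigma /time_profile mul1r mul0r addr0 add0r.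
have below y s : 0 <= s ->
    - (A * s + B) + eta * s ^+ 2 <= u (y, s) + @barrier a sigma b (y, s).
  move=> s0; rewrite /barrier/= sigmaE bE//.
  have := growth_le_coercive a y s s0; rewrite ler_norml => /andP[h1 _].
  have := kernel_ge_linear (mdist y a) s; rewrite max_l//.
  have := ler_norm (u (a, 0)); have := mulr_ge0 (ltW eta0) s0.
  rewrite /A /B; lra.
have : 0 <= u (x, t) + @barrier a sigma b (x, t).
  apply: (@supersolution_comparison a sigma time_profile_slope b time_profile_slope
    _ time_profile_derive time_profile_slope_continuous time_profile_derive
    time_profile_slope_continuous X_complete u M (- (A * M + B)) eta) => //.
  - by move=> s; rewrite sigmaE.
  - move=> s /andP[s0 _]; rewrite /time_profile_slope lerDl.
    by apply: mulr_ge0; [rewrite mulr_ge0// ltW|rewrite le_max lexx orbT].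
  - by move=> s _; rewrite /time_profile_slope mulr0 mul0r addr0.
  - move=> y s /andP[s0 sM]; apply: le_trans (below y s s0).
    have := ler_wpM2l A0 sM; have := mulr_ge0 (ltW eta0) (sqr_ge0 s); lra.
  - move=> y; rewrite /barrier/= sigmaE bE//.
    have := u0_lip y; rewrite ler_norml => /andP[h _].
    have := kernel_ge_linear (mdist y a) 0; rewrite maxxx mul0r expr0n/=; lra.
  - move=> y; have M0 : 0 <= M by lra.
    by apply: le_trans (below y M M0); lra.
  - by rewrite /= t0.
by rewrite /barrier/= sigmaE (bE t (ltW t0)) etaE; lra.
Qed.

(** If every [a] failed, the backward cone with vertex [x] would lie above [u] at time 0. Comparison
    would then bound [u (x, t)] by the barrier there, which equals [u (x, t) - e / 4]. *)
Lemma subsolution_le_kernel (x : X) (t e : R) :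
  metric_viscosity_subsolution (fun p => - H p) u -> 0 < t -> 0 < e ->
  exists a, u (x, t) <= u (a, 0) - kernel (mdist a x) t + e.
Proof.
move=> u_sub t0 e0; apply: contrapT => noa.
have {}noa a : u (a, 0) - kernel (mdist a x) t + e < u (x, t).
  by rewrite ltNge; apply/negP => ua; apply: noa; exists a.
have HK0 : 0 <= H K by apply: hamiltonian_ge0; exact: ltW.
have HK1 : 0 < 4 * (H K + 1) by lra.
(* Delaying the vertex from [t] to [T = t + 2 * h] changes the kernel by at most [2 * h * H K],
   hence by at most [e / 2]. *)
pose h := e / (4 * (H K + 1)).
have h0 : 0 < h by rewrite divr_gt0.
have hE : h * (4 * (H K + 1)) = e by rewrite divfK// gt_eqF.
have hHK : 2 * h * H K <= e / 2 by lra.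
pose eta := e / (4 * t).
have t4 : 0 < 4 * t by lra.
have eta0 : 0 < eta by rewrite divr_gt0.
have etaE : eta * (4 * t) = e by rewrite divfK// gt_eqF.
(* [M] lies strictly between [t] and [T]: the point [(x, t)] is interior in time, and the clock
   [T - s] is still positive at [M]. *)
pose M := t + h; pose T := t + 2 * h.
have tM : t < M by rewrite /M; lra.
pose l := T * H K + eps * K ^+ 2 / 2 + `|u (x, t)| + e / 2 + C * (mdist x0 x + M + 1).
have T0 : 0 <= T by rewrite /T; lra.
(* The quadratic penalty starts at time [t], where it costs nothing, and reaches [l] at time [M],
   which secures the final comparison. *)
pose B := l / h ^+ 2.
have BE : B * h ^+ 2 = l by rewrite divfK// expf_eq0/= gt_eqF.
have l0 : 0 <= l.
  have h1 : 0 <= T * H K by rewrite mulr_ge0.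
  have h2 : 0 <= eps * K ^+ 2 by rewrite mulr_ge0 ?sqr_ge0// ltW.
  have h3 : 0 <= C * (mdist x0 x + M + 1).
    by rewrite mulr_ge0//; have := mdist_ge0 x0 x; rewrite /M; lra.
  have := normr_ge0 (u (x, t)); rewrite /l; lra.
have B0 : 0 <= B by rewrite divr_ge0// sqr_ge0.
pose b := @time_profile R (u (x, t) - e / 2) eta B t.
pose sigma := @time_profile R T (- 1) (h^-1 / 2) M.
have hV : h^-1 * h = 1 by rewrite mulVf// gt_eqF.
have hV0 : 0 < h^-1 by rewrite invr_gt0.
have sigmaE s : s <= M -> sigma s = T - s.
  by move=> sM; rewrite /sigma /time_profile max_r ?subr_le0// expr0n/=; ring.
have bE s : b s = u (x, t) - e / 2 + eta * s + B * Num.max (s - t) 0 ^+ 2 by [].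
have below y s : 0 <= s -> s <= M ->
    - l + B * Num.max (s - t) 0 ^+ 2 <= @barrier x sigma b (y, s) - u (y, s).
  move=> s0 sM; rewrite /barrier/= sigmaE// bE.
  have := growth_le_coercive x y s s0; rewrite ler_norml => /andP[_ h1].
  have Ts0 : 0 <= T - s by rewrite /T; rewrite /M in sM; lra.
  have := kernel_ge_linear (mdist y x) (T - s); rewrite max_l//.
  have := ler_norm (- u (x, t)); rewrite normrN.
  have := mulr_ge0 (ltW eta0) s0; have := mulr_ge0 s0 HK0.
  have := ler_wpM2l C_ge0 sM.
  rewrite /l; lra.
have : u (x, t) <= @barrier x sigma b (x, t).
  apply: (@subsolution_comparison x sigma time_profile_slope b time_profile_slope
    _ time_profile_derive time_profile_slope_continuous time_profile_derive
    time_profile_slope_continuous X_complete u M (- l) eta) => //.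
  (* Test functions live at all positive times, so beyond [M] the clock is bent upwards; completing
     the square shows that it stays positive. *)
  - move=> s s0; have [sM|Ms] := leP s M.
      by rewrite sigmaE// /T; rewrite /M in sM; lra.
    rewrite /sigma /time_profile max_l; last by rewrite subr_ge0 ltW.
    have -> : T + -1 * s + h^-1 / 2 * (s - M) ^+ 2 =
        h^-1 / 2 * ((s - M - h) ^+ 2 + h ^+ 2).
      have -> : T + -1 * s = h - (s - M) by rewrite /T /M; ring.
      rewrite [RHS](_ : _ = h^-1 / 2 * (s - M) ^+ 2 - (h^-1 * h) * (s - M) + (h^-1 * h) * h).
        by rewrite hV; ring.
      by move: (h^-1) => v; field.
    by rewrite mulr_gt0 ?divr_gt0// ltr_wpDl ?sqr_ge0// exprn_gt0.
  - move=> s /andP[s0 _]; rewrite /time_profile_slope lerDl.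
    by apply: mulr_ge0; [exact: mulr_ge0|rewrite le_max lexx orbT].
  - move=> s /andP[_ sM]; rewrite /time_profile_slope max_r ?mulr0 ?addr0//.
    by rewrite subr_le0 ltW.
  - move=> y s /andP[s0 sM]; apply: le_trans (below y s s0 sM).
    by rewrite lerDl mulr_ge0// sqr_ge0.
  - move=> y; rewrite /barrier/= sigmaE; last by rewrite /M; lra.
    rewrite bE max_r ?sub0r ?oppr_le0 ?ltW// subr0 mulr0 expr0n/= mulr0.
    have := noa y; have := kernel_lipschitz (mdist y x) t (mdist y x) T.
    rewrite subrr normr0 mulr0 add0r ler_norml => /andP[_].
    have -> : `|t - T| = 2 * h by rewrite distrC ger0_norm /T; lra.
    lra.
  - move=> y; have M0 : 0 <= M by rewrite /M; lra.
    rewrite -subr_ge0; apply: le_trans (below y M M0 (lexx M)).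
    have -> : M - t = h by rewrite /M; ring.
    by rewrite max_l ?(ltW h0)// BE addNr.
  - by rewrite /= t0.
rewrite /barrier/= mdistxx kernel_at0 add0r bE subrr maxxx expr0n/=; lra.
Qed.

End convex_hamiltonian.

(** * Subharmoniousness *)

Section subharmonious_transfer.
Context {R : realType} {X : metricType R}.
Hypothesis X_geodesic : geodesic_space X.

(** If [y] is outside [B_r(a)], the point at distance [r] from [a] on a geodesic towards [y] is at
    distance [mdist a y - r] from [y], and the triangle inequality through [z] concludes. *)
Lemma geodesic_ball_shift {a z y : X} {r : R} : 0 <= r -> cball z r y ->
  exists2 b, cball a r b & mdist y b <= mdist a z.
Proof.
rewrite /cball/= => r0 zy.
have ay := metric_triangle a z y.
have [ar|ra] := leP (mdist a y) r.
  by exists y => //; rewrite mdistxx mdist_ge0.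
have D0 : 0 < mdist a y by exact: le_lt_trans ra.
have [gamma [g0 g1 g_geo]] := X_geodesic a y.
pose s := r / mdist a y.
have sD : s * mdist a y = r by rewrite divfK ?gt_eqF.
have s0 : 0 <= s by rewrite divr_ge0// ltW.
have s1 : s <= 1 by rewrite ler_pdivrMr// mul1r ltW.
have s_in : s \in `[0, 1] by rewrite in_itv/= s0.
have in0 : (0 : R) \in `[0, 1] by rewrite in_itv/= lexx ler01.
have in1 : (1 : R) \in `[0, 1] by rewrite in_itv/= lexx ler01.
exists (gamma s).
  by rewrite -[in mdist _ _]g0 g_geo// sub0r normrN ger0_norm// sD.
by rewrite -[in mdist y _]g1 g_geo// ger0_norm ?subr_ge0// mulrBl mul1r sD; lra.
Qed.

(** Only approximate sup-convolution bounds are asked for, with a kernel that may depend on [e],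
    since the regularized kernel represents the solution up to an error. *)
Lemma unif_infty_subharmonious_transfer {f0 f : X -> R} {delta : R} :
  lipschitz_fun f0 -> unif_infty_subharmonious delta f0 ->
  (forall e, 0 < e -> exists k : R -> R, [/\ {homo k : d d' / d <= d'},
      forall a x, f0 a - k (mdist x a) - e <= f x
    & forall x, exists a, f x <= f0 a - k (mdist a x) + e]) ->
  unif_infty_subharmonious delta f.
Proof.
move=> [L f0_lip] f0_sub approx z r /[dup] rdelta /andP[r0 _].
set S := ereal_sup _; set I := ereal_inf _.
apply/lee_addgt0Pr => e' e'0.
(* Five errors: two from [f z] counted twice, two in the bound on the supremum, one in that on the
   infimum. *)
pose e := e' / 5; have e0 : 0 < e by rewrite divr_gt0.
have [k [k_mono k_le k_ge]] := approx e e0.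
have [a za] := k_ge z.
have := f0_sub a r rdelta.
set S0 := ereal_sup _; set I0 := ereal_inf _ => f0aa.
have a_in : cball a r a by rewrite /cball/= mdistxx ltW.
have f0a x : cball a r x -> `|f0 x - f0 a| <= `|L| * r.
  move=> ax; apply: le_trans (f0_lip _ _) _; rewrite metric_sym.
  by rewrite (le_trans (ler_wpM2r (mdist_ge0 _ _) (ler_norm L)))// ler_wpM2l.
(* The Lipschitz bound on [f0] makes both extrema over the ball finite, so that they can be handled
   as reals. *)
have S0_fin : S0 \is a fin_num.
  rewrite fin_numE -ltNye -ltey; apply/andP; split.
    by apply: (@lt_le_trans _ _ (f0 a)%:E); rewrite ?ltNyr//; apply: ereal_sup_ubound; exists a.
  apply: (@le_lt_trans _ _ (f0 a + `|L| * r)%:E); last exact: ltry.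
  apply: ge_ereal_sup => _ [x /f0a + <-]; rewrite lee_fin ler_norml => /andP[]; lra.
have I0_fin : I0 \is a fin_num.
  rewrite fin_numE -ltNye -ltey; apply/andP; split.
    apply: (@lt_le_trans _ _ (f0 a - `|L| * r)%:E); first exact: ltNyr.
    apply: le_ereal_inf_tmp => _ [x /f0a + <-]; rewrite lee_fin ler_norml => /andP[]; lra.
  by apply: (@le_lt_trans _ _ (f0 a)%:E); rewrite ?ltry//; apply: ereal_inf_lbound; exists a.
have [_ [b ab <-]] := ub_ereal_sup_adherent e0 S0_fin.
rewrite -/S0 -(fineK S0_fin) -EFinB lte_fin.
rewrite -(fineK S0_fin) -(fineK I0_fin) -EFinD lee_fin in f0aa.
set s0 := fine S0 in f0aa *; set i0 := fine I0 in f0aa * => f0b.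
pose kz := k (mdist a z).
have S_ge : ((s0 - e - kz - e)%:E <= S)%E.
  have [y zy yb] := geodesic_ball_shift (a := z) (ltW r0) ab.
  apply: le_ereal_sup_tmp; exists (f y)%:E; first by exists y.
  rewrite lee_fin; apply: le_trans (k_le b y).
  have := k_mono _ _ yb; rewrite (metric_sym y b) (metric_sym z) -/kz; lra.
have I_ge : ((i0 - kz - e)%:E <= I)%E.
  apply: le_ereal_inf_tmp => _ [y zy <-]; rewrite lee_fin.
  have [c ac yc] := geodesic_ball_shift (a := a) (ltW r0) zy.
  apply: le_trans (k_le c y).
  have : i0 <= f0 c.
    by rewrite -lee_fin /i0 fineK//; apply: ereal_inf_lbound; exists c.
  have := k_mono _ _ yc; rewrite -/kz; lra.
rewrite -leeBlDr//; apply: le_trans (leeD S_ge I_ge).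
rewrite -!EFinD lee_fin; have eE : e * 5 = e' by rewrite divfK.
rewrite -/kz in za; lra.
Qed.

End subharmonious_transfer.

Theorem theorem5p11 (R : realType) (X : metricType R)
  (X_complete : complete_space_axiom X) (X_geodesic : geodesic_space X)
  (H : R -> R)
  (H_cont : {within `[0, +oo[%classic, continuous H})
  (H_mono : {in `[0, +oo[ &, {homo H : p q / p <= q}})
  (H_convex : convex_function (`[0, +oo[%classic : set R) H)
  (H0 : H 0 = 0)
  (H_superlinear : H p / p @[p --> +oo] --> +oo)
  (u0 : X -> R) (u0_lip : lipschitz_fun u0)
  (x0 : X) (u : X * R -> R)
  (u_cont : {within [set z : X * R | 0 <= z.2], continuous u})
  (u_growth : linear_growth x0 u)
  (u_sol : metric_viscosity_solution (fun p => - H p) u)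
  (u_init : forall x, u (x, 0) = u0 x)
  (delta : R) (delta_gt0 : 0 < delta) :
  unif_infty_subharmonious delta u0 ->
  forall t : R, 0 <= t -> unif_infty_subharmonious delta (fun x => u (x, t)).
Proof.
move=> u0_sub t; rewrite le_eqVlt => /predU1P[<-|t0].
  by rewrite (_ : (fun x => u (x, 0)) = u0)//; apply/funext.
apply: (unif_infty_subharmonious_transfer X_geodesic u0_lip u0_sub) => e e0.
have [C C_growth] := u_growth; have [L L_lip] := u0_lip.
have [u_sub u_super] := u_sol.
(* [K] must dominate the growth rate of [u] and the Lipschitz constant of [u0], and be positive. *)
pose K := `|C| + `|L| + 1.
have C0 := normr_ge0 C; have L0 := normr_ge0 L.
have K0 : 0 < K by rewrite /K; lra.
have CK : `|C| <= K by rewrite /K; lra.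
have LK : L <= K by have := ler_norm L; rewrite /K; lra.
(* Chosen so that the regularization loss [eps * K ^+ 2 / 2] equals [e]. *)
pose eps := 2 * e / K ^+ 2.
have K20 : 0 < K ^+ 2 by rewrite exprn_gt0.
have eps0 : 0 < eps by rewrite divr_gt0// mulr_gt0.
have epsE : eps * K ^+ 2 / 2 = e by rewrite divfK ?gt_eqF// mulrAC divff// mul1r.
have growth x s : 0 <= s -> `|u (x, s)| <= `|C| * (mdist x0 x + s + 1).
  move=> s0; apply: le_trans (C_growth _ _ s0) _.
  by rewrite ler_wpM2r ?ler_norm// !addr_ge0// mdist_ge0.
exists ((@kernel _ H K eps)^~ t); split=> [d d' dd'|a x|x].
- by apply: kernel_mono.
- rewrite -u_init -[X in _ - X <= _]epsE.
  apply: (supersolution_ge_kernel H_mono H_convex H0 K0 eps0 X_geodesic X_complete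
    u_cont C0 CK growth) => // y.
  by rewrite !u_init (le_trans (L_lip _ _))// ler_wpM2r// mdist_ge0.
- have [a] := subsolution_le_kernel H_mono H_convex H0 K0 eps0 X_geodesic X_complete
    u_cont C0 CK growth x t e u_sub t0 e0.
  by rewrite u_init; exists a.
Qed.
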